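(* Let $\Psi=\{\alpha;\beta^1,\dots,\beta^r\}\subset L_1(\mathbb{R})$ ($r\ge 1$) be associated with a filter bank $\{a;b_1,\dots,b_r\}\subset l_1(\mathbb{Z})$, i.e. $\widehat{\alpha}(2\xi)=\widehat{a}(\xi)\widehat{\alpha}(\xi)$ and $\widehat{\beta^n}(2\xi)=\widehat{b_n}(\xi)\widehat{\alpha}(\xi)$ for all $\xi\in\mathbb{R}$, $n=1,\dots,r$. Suppose that, on the half-line $[0,\infty)$, the supports of $\widehat{\alpha}$ and of $\widehat{\beta^n}$, $n=1,\dots,r$, are subsets of $[0,1/2]$, and that $$\lim_{j\to\infty}\widehat{a}\Big(\frac{\lambda_\ell}{2^j}\Big)=1,\qquad \Big|\widehat{a}\Big(\frac{\lambda_\ell}{2^j}\Big)\Big|^2+\sum_{n=1}^r\Big|\widehat{b_n}\Big(\frac{\lambda_\ell}{2^j}\Big)\Big|^2=1\qquad\text{for all } j,\ell\in\mathbb{N}_0,$$ where $\lambda_\ell=\sqrt{\ell(\ell+2)}$. Let $Q_{N_j}$, $j\in\mathbb{N}_0$, be a sequence of quadrature rules on the simplex $T^2$, and let $\boldsymbol{\varphi}_{j,k}$, $\boldsymbol{\psi}^n_{j,k'}$ be the associated semi-discrete framelets. For $f\in L_2(T^2)$ let $\mathrm{v}_j$ and $\mathrm{w}^n_j$ be the sequences of framelet coefficients $$(\mathrm{v}_j)_k=\langle f,\boldsymbol{\varphi}_{j,k}\rangle,\ k=1,\dots,N_j,\qquad (\mathrm{w}^n_j)_{k'}=\langle f,\boldsymbol{\psi}^n_{j,k'}\rangle,\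 k'=1,\dots,N_{j+1}.$$ Then for every $j\ge 1$, $$\mathrm{v}_j=(\mathrm{v}_{j-1}\uparrow_j)\ast_j a+\sum_{n=1}^r \mathrm{w}^n_{j-1}\ast_j b_n.$$
   Context: $\mathbb{N}_0=\{0,1,2,\dots\}$. **Simplex and basis.** $T^2=\{(x_1,x_2): x_1\ge 0,\ x_2\ge 0,\ x_1+x_2\le 1\}$, and $\mu$ is Lebesgue area measure normalized so that $\mu(T^2)=1$. $L_2(T^2)$ is the space of complex-valued square-integrable functions with inner product $\langle f,g\rangle=\int_{T^2} f\,\overline{g}\,d\mu$. For $\ell\in\mathbb{N}_0$, $\mathcal{V}_\ell$ is the $(\ell+1)$-dimensional space of polynomials of degree $\ell$ on $T^2$ that are orthogonal in $L_2(T^2)$ to all polynomials of lower degree (together with $0$). Fix an orthonormal basis $\{P_{\ell,m}: m=0,\dots,\ell\}$ of each $\mathcal{V}_\ell$; then $\{P_{\ell,m}: 0\le m\le \ell,\ \ell\ge 0\}$ is an orthonormal basis of $L_2(T^2)$. Put $\widehat{f}_{\ell,m}=\langle f,P_{\ell,m}\rangle$. Below, $\sum_{\ell,m}$ means $\sum_{\ell=0}^\infty\sum_{m=0}^{\ell}$. **Fourier conventions.** For $g\in L_1(\mathbb{R})$, $\widehat{g}(\xi)=\int_{\mathbb{R}} g(x)e^{-2\pi i x\xi}\,dx$. For $h=(h_k)_{k\in\mathbb{Z}}\in l_1(\mathbb{Z})$ (a mask), $\widehat{h}(\xi)=\sum_{k\in\mathbb{Z}}h_k e^{-2\pi i k\xi}$.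 **Quadrature rules and framelets.** $Q_{N_j}=\{(\omega_{j,k},\boldsymbol{x}_{j,k})\}_{k=1}^{N_j}$ consists of weights $\omega_{j,k}>0$ and points $\boldsymbol{x}_{j,k}\in T^2$ (no polynomial exactness is assumed). The semi-discrete framelets are $$\boldsymbol{\varphi}_{j,k}(\boldsymbol{x})=\sqrt{\omega_{j,k}}\sum_{\ell,m}\widehat{\alpha}\Big(\frac{\lambda_\ell}{2^j}\Big)\overline{P_{\ell,m}(\boldsymbol{x}_{j,k})}P_{\ell,m}(\boldsymbol{x}),\quad k=1,\dots,N_j,$$ $$\boldsymbol{\psi}^n_{j,k'}(\boldsymbol{x})=\sqrt{\omega_{j+1,k'}}\sum_{\ell,m}\widehat{\beta^n}\Big(\frac{\lambda_\ell}{2^j}\Big)\overline{P_{\ell,m}(\boldsymbol{x}_{j+1,k'})}P_{\ell,m}(\boldsymbol{x}),\quad k'=1,\dots,N_{j+1},\ n=1,\dots,r.$$ **Sequences and their Fourier coefficients.** $l(Q_{N_j})$ is the set of sequences $\mathrm{v}=(\mathrm{v}_k)_{k=1}^{N_j}$ of the form $(\mathrm{v})_k=\sqrt{\omega_{j,k}}\sum_{\ell,m}\mathrm{u}_{\ell,m}P_{\ell,m}(\boldsymbol{x}_{j,k})$ with $\mathrm{u}$ absolutely summable. Each such $\mathrm{v}$ is regarded as carrying the representing sequence $\mathrm{u}$, and one writes $\widehat{\mathrm{v}}_{\ell,m}:=\mathrm{u}_{\ell,m}$ (the generalized Fourier coefficients of $\mathrm{v}$). The framelet coefficient sequences of $f$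 are regarded as elements $\mathrm{v}_j\in l(Q_{N_j})$ with $\widehat{(\mathrm{v}_j)}_{\ell,m}=\widehat{f}_{\ell,m}\,\overline{\widehat{\alpha}(\lambda_\ell/2^j)}$ and $\mathrm{w}^n_{j}\in l(Q_{N_{j+1}})$ with $\widehat{(\mathrm{w}^n_{j})}_{\ell,m}=\widehat{f}_{\ell,m}\,\overline{\widehat{\beta^n}(\lambda_\ell/2^{j})}$. **Convolution.** For $\mathrm{v}\in l(Q_{N_j})$ and a mask $h$, $\mathrm{v}\ast_j h\in l(Q_{N_j})$ is $$(\mathrm{v}\ast_j h)_k=\sum_{\ell,m}\widehat{\mathrm{v}}_{\ell,m}\,\widehat{h}\Big(\frac{\lambda_\ell}{2^j}\Big)\sqrt{\omega_{j,k}}\,P_{\ell,m}(\boldsymbol{x}_{j,k}),\quad k=1,\dots,N_j,$$ with Fourier coefficients $\widehat{\mathrm{v}}_{\ell,m}\widehat{h}(\lambda_\ell/2^j)$. **Upsampling.** For $j\ge1$ and $\mathrm{v}\in l(Q_{N_{j-1}})$, $\mathrm{v}\uparrow_j\in l(Q_{N_j})$ is $$(\mathrm{v}\uparrow_j)_k=\sum_{\ell:\,\lambda_\ell\le 2^{j-2}}\sum_{m=0}^{\ell}\widehat{\mathrm{v}}_{\ell,m}\sqrt{\omega_{j,k}}\,P_{\ell,m}(\boldsymbol{x}_{j,k}),\quad k=1,\dots,N_j,$$ with Fourier coefficients $\widehat{\mathrm{v}}_{\ell,m}$ for $\lambda_\ell\le 2^{j-2}$ and $0$ otherwise. *)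

(* Defs.v *)
From HB Require Import structures.
From mathcomp Require Import all_boot all_order all_algebra.
From mathcomp Require Import all_classical all_reals all_analysis.
From mathcomp Require Import measurable_realfun.
From mathcomp Require Import complex.
From mathcomp Require mpoly.
(* The notations of mpoly are incompatible with those of mathcomp-analysis. *)
Import -(notations) mpoly.
Import Order.TTheory GRing.Theory Num.Theory numFieldNormedType.Exports.

Set Implicit Arguments.
Unset Strict Implicit.
Unset Printing Implicit Defensive.

Local Open Scope classical_set_scope.
Local Open Scope ring_scope.

Section ComplexAnalysis.
Context {R : realType}.
Local Notation C := R[i].

(* The modulus as an element of R; `|z| lives in R[i]. *)
Definition modulus (z : C) : R := ComplexField.Normc.normc z.

Definition cis (t : R) : C := Complex (cos t) (sin t).

(* The topology on complex numbers is that of the normed space C^o. *)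
Definition csum (u : nat -> C) : C := limn (series (u : nat -> C^o)).

Definition cmeasurable d (T : measurableType d) (D : set T) (f : T -> C) :=
  measurable_fun D (fun x => complex.Re (f x)) /\
  measurable_fun D (fun x => complex.Im (f x)).

Definition cintegral d (T : measurableType d) (m : {measure set T -> \bar R})
    (D : set T) (f : T -> C) : C :=
  Complex (\int[m]_(x in D) complex.Re (f x))
          (\int[m]_(x in D) complex.Im (f x)).

Definition in_Lp (p : nat) d (T : measurableType d)
    (m : {measure set T -> \bar R}) (D : set T) (f : T -> C) : Prop :=
  cmeasurable D f /\ (\int[m]_(x in D) (modulus (f x) ^+ p)%:E < +oo)%E.

Definition fourier (g : R -> C) (xi : R) : C :=
  cintegral lebesgue_measure setT (fun x => g x * cis (- (2 * pi * x * xi))).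

Definition l1_mask (h : int -> C) : Prop :=
  (\esum_(k in [set: int]) (modulus (h k))%:E < +oo)%E.

(* Bilateral series, as the limit of the partial sums over -n <= k <= n. *)
Definition mask_fourier (h : int -> C) (xi : R) : C :=
  limn (fun n : nat => (\sum_(i < n.*2.+1) h (i%:Z - n%:Z) *
                   cis (- (2 * pi * (i%:Z - n%:Z)%:~R * xi))) : C^o).

End ComplexAnalysis.

Section Simplex.
Context {R : realType}.
Local Notation C := R[i].
Local Notation plane := (measurableTypeR R * measurableTypeR R)%type.

Definition T2 : set plane :=
  [set x | [/\ 0 <= x.1, 0 <= x.2 & x.1 + x.2 <= 1]].

Definition area : {measure set plane -> \bar R} :=
  (lebesgue_measure \x lebesgue_measure)%E.

(* Normalized so that T2 has mass 1, see mu_T2. *)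
Definition mu : {measure set plane -> \bar R} := mscale (2%:R%:nng) area.

Lemma measurable_T2 : measurable T2.
Proof.
have -> : T2 = (fst @^-1` `[0, +oo[%classic) `&` (snd @^-1` `[0, +oo[%classic)
    `&` ((fun x : plane => x.1 + x.2 : R) @^-1` `]-oo, 1]%classic).
  apply/seteqP; split=> x /=; rewrite !in_itv/= !andbT.
    by case.
  by case=> -[].
apply: measurableI; first apply: measurableI.
- by rewrite -[X in measurable X]setTI; apply: measurable_fst.
- by rewrite -[X in measurable X]setTI; apply: measurable_snd.
- rewrite -[X in measurable X]setTI.
  have : measurable_fun setT (fun x : plane => x.1 + x.2 : R).
    by apply: measurable_funD; [exact: measurable_fst|exact: measurable_snd].
  by apply.
Qed.

Lemma mu_T2 : mu T2 = 1%E.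
Proof.
have -> : mu T2 = (2%:E * area T2)%E by [].
suff -> : area T2 = (2^-1)%:E by rewrite -EFinM divff.
rewrite /area /= /product_measure1 /=.
transitivity (\int[@lebesgue_measure R]_(x in `[0%R, 1%R]) (unstable.onem x ^+ 1)%:E)%E.
  rewrite [RHS]integral_mkcond; apply: eq_integral => x _.
  rewrite /= patchE; case: ifPn => [|] /=; rewrite ?inE/= ?notin_setE/= in_itv/=.
    move=> /andP[x0 x1].
    have -> : xsection T2 x = `[0, 1 - x]%classic.
      apply/seteqP; split => y; rewrite /xsection/= inE /T2/= in_itv/=.
        by move=> [_ -> xy]; rewrite lerBrDl.
      by move=> /andP[y0 y1]; split=> //; rewrite -lerBrDl.
    rewrite lebesgue_measure_itv/= lte_fin subr_gt0 expr1.
    case: ltP => x1'; first by rewrite -EFinD subr0.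
    by have -> : x = 1; [apply/eqP; rewrite eq_le x1|rewrite unstable.onem1].
  move=> nx; have -> : xsection T2 x = set0; last by rewrite measure0.
  apply/seteqP; split => y //; rewrite /xsection/= inE /T2/= => -[x0 y0 xy].
  apply: nx; rewrite x0/=; apply: le_trans xy; by rewrite lerDl.
have := @Rintegral_onemXn R 1; rewrite /Rintegral => <-.
rewrite fineK//; apply: integrable_fin_num => //.
apply: continuous_compact_integrable; first exact: segment_compact.
by apply: continuous_in_subspaceT => x _; exact: continuous_onemXn.
Qed.

Definition inner (f g : plane -> C) : C :=
  cintegral mu T2 (fun x => f x * conjc (g x)).

Definition L2 (f : plane -> C) : Prop := in_Lp 2 mu T2 f.

Definition peval (p : mpoly 2 C) (x : plane) : C :=
  meval (fun i : 'I_2 => Complex (if i == ord0 then x.1 else x.2) 0) p.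

(* msize is the total degree plus one, and msize 0 = 0. *)
Definition inV (l : nat) (p : mpoly 2 C) : Prop :=
  p = 0 \/
  (msize p = l.+1 /\
   forall q : mpoly 2 C, (msize q <= l)%N -> inner (peval p) (peval q) = 0).

Definition orthonormal_basis (l : nat) (B : 'I_l.+1 -> mpoly 2 C) : Prop :=
  [/\ forall m, inV l (B m),
      forall m m', inner (peval (B m)) (peval (B m')) = (m == m')%:R &
      forall p, inV l p ->
        exists c : 'I_l.+1 -> C, p = \sum_(m < l.+1) c m *: B m].

Definition lambda (l : nat) : R := Num.sqrt (l * (l + 2))%:R.

End Simplex.

Section Framelets.
Context {R : realType}.
Local Notation C := R[i].
Local Notation plane := (measurableTypeR R * measurableTypeR R)%type.

Record quadrature := Quadrature {
  qsize : nat;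
  weight : 'I_qsize -> R;
  node : 'I_qsize -> plane;
  weight_gt0 : forall k, 0 < weight k;
  node_T2 : forall k, T2 (node k) }.

Variable P : forall l : nat, 'I_l.+1 -> mpoly 2 C.

(* Families u_{l,m} with 0 <= m <= l. *)
Definition coeffs := forall l : nat, 'I_l.+1 -> C.

Definition dsum (u : coeffs) : C := csum (fun l => \sum_(m < l.+1) u l m).

Definition abs_summable (u : coeffs) : Prop :=
  (\sum_(0 <= l <oo) (\sum_(m < l.+1) modulus (u l m))%:E < +oo)%E.

Definition fcoef (f : plane -> C) : coeffs :=
  fun l m => inner f (peval (P m)).

Definition framelet (q : quadrature) (c : nat -> C) (k : 'I_(qsize q))
    (x : plane) : C :=
  Complex (Num.sqrt (weight k)) 0 *
  dsum (fun l m => c l * conjc (peval (P m) (node k)) * peval (P m) x).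

Definition phi (Q : nat -> quadrature) (alpha : R -> C) (j : nat) :
    'I_(qsize (Q j)) -> plane -> C :=
  framelet (fun l => fourier alpha (lambda l / 2 ^+ j)).

Definition psi (Q : nat -> quadrature) (beta : R -> C) (j : nat) :
    'I_(qsize (Q j.+1)) -> plane -> C :=
  framelet (fun l => fourier beta (lambda l / 2 ^+ j)).

(* A sequence on the nodes together with the representing family it carries;
   nothing ties the two together until in_lQ does. *)
Record qseq (q : quadrature) := QSeq {
  entry :> 'I_(qsize q) -> C;
  coef : coeffs }.

Definition synthesis (q : quadrature) (u : coeffs) (k : 'I_(qsize q)) : C :=
  Complex (Num.sqrt (weight k)) 0 *
  dsum (fun l m => u l m * peval (P m) (node k)).

Definition in_lQ (q : quadrature) (v : qseq q) : Prop :=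
  abs_summable (coef v) /\ forall k, v k = synthesis (coef v) k.

Definition of_coeffs (q : quadrature) (u : coeffs) : qseq q :=
  QSeq (@synthesis q u) u.

Definition convolve (Q : nat -> quadrature) (j : nat) (v : qseq (Q j))
    (h : int -> C) : qseq (Q j) :=
  of_coeffs (Q j)
    (fun l m => coef v m * mask_fourier h (lambda l / 2 ^+ j)).

(* The exponent j - 2 is an integer. *)
Definition upsample (Q : nat -> quadrature) (j : nat) (v : qseq (Q j.-1)) :
    qseq (Q j) :=
  of_coeffs (Q j)
    (fun l m => if lambda l <= (2 : R) ^ (j%:Z - 2) then coef v m else 0).

Definition vseq (Q : nat -> quadrature) (alpha : R -> C) (f : plane -> C)
    (j : nat) : qseq (Q j) :=
  QSeq (fun k => inner f (@phi Q alpha j k))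
       (fun l m => fcoef f m * conjc (fourier alpha (lambda l / 2 ^+ j))).

Definition wseq (Q : nat -> quadrature) (beta : R -> C) (f : plane -> C)
    (j : nat) : qseq (Q j.+1) :=
  QSeq (fun k => inner f (@psi Q beta j k))
       (fun l m => fcoef f m * conjc (fourier beta (lambda l / 2 ^+ j))).

End Framelets.

Arguments phi {R} P Q alpha {j}.
Arguments psi {R} P Q beta {j}.
Arguments in_lQ {R} P {q} v.
Arguments convolve {R} P Q j v h.
Arguments upsample {R} P Q j v.
Arguments vseq {R} P Q alpha f j.
Arguments wseq {R} P Q beta f j.

(* Main.v *)
Require Import Defs.
From HB Require Import structures.
From mathcomp Require Import all_boot all_order all_algebra.
From mathcomp Require Import all_classical all_reals all_analysis.
From mathcomp Require Import measurable_realfun.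
From mathcomp Require Import complex ring lra.
From mathcomp Require mpoly.
Import Order.TTheory GRing.Theory Num.Theory numFieldNormedType.Exports.

(** The decomposition is an identity between Fourier coefficients.  Write g^
    for the Fourier transform of a function or a mask g, fix a degree l and
    put xi = lambda l / 2 ^ (j + 1).  The refinement equations
    give alpha^(2 xi) = a^(xi) alpha^(xi) and
    beta_n^(2 xi) = b_n^(xi) alpha^(xi), so the coefficients on the right-hand
    side of the decomposition add up to the coefficient of f times
      (|a^(xi)|^2 + \sum_n |b_n^(xi)|^2) * conj (alpha^(xi)),
    and the bracket is 1.  Upsampling cuts the spectrum at
    lambda l <= 2 ^ (j - 1), that is at 2 xi <= 1/2; the support of alpha^
    makes the coefficients of v_j vanish beyond that point already, so the
    cut changes nothing.

    Convergence is never at stake: since l <= lambda l, the support condition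
    leaves only the degrees l < 2 ^ j in the framelets of level j, and all the
    series over l are finite sums (dsum_finite).  This gives absolute
    summability (abs_summable_finite), and the additivity of the synthesis
    operator (synthesisD, synthesis_sum) carries the identity from
    coefficients to entries.

    What remains is that the framelet coefficients of f, defined as inner
    products, are the synthesis of the coefficients that they carry
    (inner_framelet).  A framelet is a finite linear combination of
    polynomials, so this is linearity of the integral; it needs f times a
    polynomial to be integrable on the simplex, which holds because f is
    square-integrable, polynomials are bounded there, and the simplex has
    finite measure (cintegrable_L2_bounded). *)

Set Implicit Arguments.
Unset Strict Implicit.
Unset Printing Implicit Defensive.

Local Open Scope classical_set_scope.
Local Open Scope ring_scope.

(** * The modulus of a complex number *)

Section modulus.
Context {R : realType}.
Implicit Types z w : R[i].

Lemma modulusM z w : modulus (z * w) = modulus z * modulus w.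
Proof. exact: ComplexField.Normc.normcM. Qed.

Lemma modulusD z w : modulus (z + w) <= modulus z + modulus w.
Proof. exact: le_normcD. Qed.

Lemma modulus_ge0 z : 0 <= modulus z.
Proof. by case: z => x y; exact: sqrtr_ge0. Qed.

Lemma modulusE z : modulus z ^+ 2 = complex.Re z ^+ 2 + complex.Im z ^+ 2.
Proof.
by case: z => x y; rewrite /modulus /= sqr_sqrtr// addr_ge0// sqr_ge0.
Qed.

Lemma modulus_conjc z : modulus (conjc z) = modulus z.
Proof. by case: z => x y; rewrite /modulus /= sqrrN. Qed.

Lemma mul_conjc z : z * conjc z = Complex (modulus z ^+ 2) 0.
Proof.
rewrite modulusE; case: z => x y.
by apply/eqP; rewrite eq_complex/=; apply/andP; split; apply/eqP; ring.
Qed.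

Lemma Re_le_modulus z : `|complex.Re z| <= modulus z.
Proof.
by rewrite -(ler_pXn2r (n := 2)) ?nnegrE ?modulus_ge0// real_normK ?num_real//
  modulusE lerDl sqr_ge0.
Qed.

Lemma Im_le_modulus z : `|complex.Im z| <= modulus z.
Proof.
by rewrite -(ler_pXn2r (n := 2)) ?nnegrE ?modulus_ge0// real_normK ?num_real//
  modulusE lerDr sqr_ge0.
Qed.

Lemma ReM z w : complex.Re (z * w) =
  complex.Re z * complex.Re w - complex.Im z * complex.Im w.
Proof. by case: z => ? ?; case: w. Qed.

Lemma ImM z w : complex.Im (z * w) =
  complex.Re z * complex.Im w + complex.Im z * complex.Re w.
Proof. by case: z => ? ?; case: w. Qed.

Lemma ReD z w : complex.Re (z + w) = complex.Re z + complex.Re w.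
Proof. by case: z => ? ?; case: w. Qed.

Lemma ImD z w : complex.Im (z + w) = complex.Im z + complex.Im w.
Proof. by case: z => ? ?; case: w. Qed.

Lemma Re_conjc z : complex.Re (conjc z) = complex.Re z.
Proof. by case: z. Qed.

Lemma Im_conjc z : complex.Im (conjc z) = - complex.Im z.
Proof. by case: z. Qed.

End modulus.
(** * Complex-valued integrals *)

Section integration.
Context {R : realType} d (T : measurableType d).
Variables (m : {measure set T -> \bar R}) (D : set T).
Hypothesis mD : measurable D.
Implicit Types f g : T -> R[i].

Lemma cmeasurable_cst (c : R[i]) : cmeasurable D (fun=> c).
Proof. by split; exact: measurable_cst. Qed.

Lemma cmeasurableD f g : cmeasurable D f -> cmeasurable D g ->
  cmeasurable D (fun x => f x + g x).
Proof.
move=> [fr fi] [gr gi]; split.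
  by under eq_fun do rewrite ReD; exact: measurable_funD.
by under eq_fun do rewrite ImD; exact: measurable_funD.
Qed.

Lemma cmeasurableM f g : cmeasurable D f -> cmeasurable D g ->
  cmeasurable D (fun x => f x * g x).
Proof.
move=> [fr fi] [gr gi]; split.
  under eq_fun do rewrite ReM.
  by apply: measurable_funB; exact: measurable_funM.
under eq_fun do rewrite ImM.
by apply: measurable_funD; exact: measurable_funM.
Qed.

Lemma cmeasurable_conjc f : cmeasurable D f ->
  cmeasurable D (fun x => conjc (f x)).
Proof.
move=> [fr fi]; split; first by under eq_fun do rewrite Re_conjc.
by under eq_fun do rewrite Im_conjc; exact: measurableT_comp.
Qed.

Definition cbounded f :=
  cmeasurable D f /\ exists M, forall x, D x -> modulus (f x) <= M.

Lemma cbounded_cst (c : R[i]) : cbounded (fun=> c).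
Proof. by split; [exact: cmeasurable_cst|exists (modulus c)]. Qed.

Lemma cboundedD f g : cbounded f -> cbounded g -> cbounded (fun x => f x + g x).
Proof.
move=> [mf [M fM]] [mg [N gN]]; split; first exact: cmeasurableD.
exists (M + N) => x Dx; apply: le_trans (modulusD _ _) _.
by rewrite lerD ?fM ?gN.
Qed.

Lemma cboundedM f g : cbounded f -> cbounded g -> cbounded (fun x => f x * g x).
Proof.
move=> [mf [M fM]] [mg [N gN]]; split; first exact: cmeasurableM.
exists (M * N) => x Dx; rewrite modulusM.
by rewrite ler_pM ?modulus_ge0 ?fM ?gN.
Qed.

Lemma cbounded_sum (I : Type) (s : seq I) (F : I -> T -> R[i]) :
  (forall i, cbounded (F i)) -> cbounded (fun x => \sum_(i <- s) F i x).
Proof.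
move=> bF; elim: s => [|i s ih].
  by under eq_fun do rewrite big_nil; exact: cbounded_cst.
by under eq_fun do rewrite big_cons; exact: cboundedD.
Qed.

Lemma cbounded_prod (I : Type) (s : seq I) (F : I -> T -> R[i]) :
  (forall i, cbounded (F i)) -> cbounded (fun x => \prod_(i <- s) F i x).
Proof.
move=> bF; elim: s => [|i s ih].
  by under eq_fun do rewrite big_nil; exact: cbounded_cst.
by under eq_fun do rewrite big_cons; exact: cboundedM.
Qed.

Lemma cboundedX f n : cbounded f -> cbounded (fun x => f x ^+ n).
Proof.
move=> bf; elim: n => [|n ih]; first exact: cbounded_cst.
by under eq_fun do rewrite exprS; exact: cboundedM.
Qed.

Definition cintegrable f :=
  m.-integrable D (fun x => (complex.Re (f x))%:E) /\
  m.-integrable D (fun x => (complex.Im (f x))%:E).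

Lemma cintegrableD f g : cintegrable f -> cintegrable g ->
  cintegrable (fun x => f x + g x).
Proof.
move=> [fr fi] [gr gi]; split.
  by under eq_fun do rewrite ReD EFinD; exact: integrableD.
by under eq_fun do rewrite ImD EFinD; exact: integrableD.
Qed.

Lemma cintegrableZ (c : R[i]) f : cintegrable f ->
  cintegrable (fun x => c * f x).
Proof.
move=> [fr fi]; split.
  under eq_fun do rewrite ReM EFinB !EFinM.
  by apply: integrableB => //; exact: integrableZl.
under eq_fun do rewrite ImM EFinD !EFinM.
by apply: integrableD => //; exact: integrableZl.
Qed.

Lemma cintegrable0 : cintegrable (fun=> 0).
Proof. by split; exact: integrable0. Qed.

Lemma cintegralD f g : cintegrable f -> cintegrable g ->
  cintegral m D (fun x => f x + g x) = cintegral m D f + cintegral m D g.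
Proof.
move=> [fr fi] [gr gi]; rewrite /cintegral.
under eq_Rintegral do rewrite ReD.
rewrite RintegralD//.
under [X in Complex _ X]eq_Rintegral do rewrite ImD.
by rewrite RintegralD.
Qed.

Lemma cintegralZ (c : R[i]) f : cintegrable f ->
  cintegral m D (fun x => c * f x) = c * cintegral m D f.
Proof.
move=> [fr fi]; rewrite /cintegral.
have iZ k h : m.-integrable D (EFin \o h) ->
    m.-integrable D (EFin \o (fun x => k * h x)).
  exact: integrableZl.
under eq_Rintegral do rewrite ReM.
rewrite RintegralB; [|by []|exact: iZ|exact: iZ].
under [X in Complex _ X]eq_Rintegral do rewrite ImM.
rewrite RintegralD; [|by []|exact: iZ|exact: iZ].
by rewrite !RintegralZl//; case: c.
Qed.

Lemma cintegral0 : cintegral m D (fun=> 0) = 0.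
Proof. by rewrite /cintegral /Rintegral !integral0. Qed.

Lemma cintegral_sum (I : Type) (s : seq I) (F : I -> T -> R[i]) :
  (forall i, cintegrable (F i)) ->
  cintegrable (fun x => \sum_(i <- s) F i x) /\
  cintegral m D (fun x => \sum_(i <- s) F i x) =
    \sum_(i <- s) cintegral m D (F i).
Proof.
move=> iF; elim: s => [|i s [ihi ih]].
  under eq_fun do rewrite big_nil.
  by rewrite big_nil; split; [exact: cintegrable0|exact: cintegral0].
under eq_fun do rewrite big_cons.
by rewrite big_cons -ih; split; [exact: cintegrableD|exact: cintegralD].
Qed.

(* From here on D has finite measure, so that L2 is contained in L1. *)
Hypothesis finD : (m D < +oo)%E.

(** If |g| <= M, then |f g| <= M |f| <= M (1 + |f|^2), and the constant 1 is
    integrable on a set of finite measure. *)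
Lemma cintegrable_L2_bounded f g : in_Lp 2 m D f -> cbounded g ->
  cintegrable (fun x => f x * g x).
Proof.
move=> [mf f2] [mg [M gM]].
have mod2 : measurable_fun D (fun x => modulus (f x) ^+ 2).
  under eq_fun do rewrite modulusE.
  by case: mf => mr mi; apply: measurable_funD; exact: measurable_funX.
have int2 : m.-integrable D (fun x => (modulus (f x) ^+ 2)%:E).
  apply/integrableP; split; first exact/measurable_EFinP.
  by under eq_integral do rewrite /= ger0_norm ?sqr_ge0//.
have int1 : m.-integrable D (EFin \o (cst 1 : T -> R)).
  apply: measurable_bounded_integrable => //.
  exact: bounded_cst.
have intM : m.-integrable D
    (fun x => `|M|%:E * (1 + (modulus (f x) ^+ 2)%:E))%E.
  by apply: integrableZl => //; exact: (integrableD mD int1 int2).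
have le_dom x : D x -> modulus (f x * g x) <= `|M| * (1 + modulus (f x) ^+ 2).
  move=> Dx; rewrite modulusM mulrC ler_pM ?modulus_ge0//.
    exact: le_trans (gM _ Dx) (ler_norm _).
  by have := sqr_ge0 (modulus (f x) - 1); have := modulus_ge0 (f x); nra.
have dom x : D x -> (`|modulus (f x * g x)| <=
    `|(`|M| * (1 + modulus (f x) ^+ 2))%R|).
  by move=> Dx; rewrite [leLHS]ger0_norm ?modulus_ge0//
    (le_trans (le_dom _ Dx))// ler_norm.
have [mr mi] := cmeasurableM mf mg.
split; (apply: le_integrable intM => //; first exact/measurable_EFinP);
  move=> x Dx; rewrite -EFinD -EFinM lee_fin.
  apply: le_trans (Re_le_modulus _) (le_trans _ (dom _ Dx)); exact: ler_norm.
apply: le_trans (Im_le_modulus _) (le_trans _ (dom _ Dx)); exact: ler_norm.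
Qed.

End integration.

(** * Inner products with polynomials on the simplex *)

Section simplex.
Context {R : realType}.
Local Notation plane := (measurableTypeR R * measurableTypeR R)%type.
Implicit Types (f : plane -> R[i]).

(** A polynomial is a finite sum of products of coordinates, and the
    coordinates lie between 0 and 1 on the simplex. *)
Lemma cbounded_peval (p : mpoly.mpoly 2 R[i]) : cbounded T2 (peval p).
Proof.
rewrite /peval; under eq_fun do rewrite mpoly.mevalE.
apply: cbounded_sum => e; apply: cboundedM; first exact: cbounded_cst.
apply: cbounded_prod => i; apply: cboundedX; split.
  split; last exact: measurable_cst.
  by case: (i == ord0); apply: measurable_funTS;
    [exact: measurable_fst|exact: measurable_snd].
exists 1 => x [x1 x2 x12].
have x1' : x.1 <= 1 by apply: le_trans x12; rewrite lerDl.
have x2' : x.2 <= 1 by apply: le_trans x12; rewrite lerDr.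
rewrite /modulus /= expr0n /= addr0 sqrtr_sqr.
by case: (i == ord0); rewrite ger0_norm.
Qed.

Lemma cintegrable_inner f (p : mpoly.mpoly 2 R[i]) : L2 f ->
  cintegrable mu T2 (fun x => f x * conjc (peval p x)).
Proof.
move=> fL2; apply: cintegrable_L2_bounded => //.
- exact: measurable_T2.
- by rewrite mu_T2 ltry.
have [mp [M pM]] := cbounded_peval p; split; first exact: cmeasurable_conjc.
by exists M => x Dx; rewrite modulus_conjc pM.
Qed.

Lemma inner_sum f (I : Type) (s : seq I) (c : I -> R[i])
    (p : I -> mpoly.mpoly 2 R[i]) : L2 f ->
  inner f (fun x => \sum_(i <- s) c i * peval (p i) x) =
  \sum_(i <- s) conjc (c i) * inner f (peval (p i)).
Proof.
move=> fL2; rewrite /inner.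
have ip i := cintegrable_inner (p i) fL2.
transitivity (cintegral mu T2 (fun x =>
    \sum_(i <- s) conjc (c i) * (f x * conjc (peval (p i) x)))).
  congr cintegral; apply/funext => x.
  rewrite rmorph_sum mulr_sumr; apply: eq_bigr => i _.
  by rewrite rmorphM mulrCA.
have iZ i := cintegrableZ measurable_T2 (conjc (c i)) (ip i).
rewrite (cintegral_sum measurable_T2 s iZ).2.
by apply: eq_bigr => i _; rewrite cintegralZ//; exact: measurable_T2.
Qed.

End simplex.

(** * Families supported in finitely many degrees *)

Section finite_support.
Context {R : realType}.
Local Notation plane := (measurableTypeR R * measurableTypeR R)%type.

Definition vanishes_from (L : nat) (u : @coeffs R) :=
  forall l (m : 'I_l.+1), (L <= l)%N -> u l m = 0.

(** The partial sums are constant from L on. *)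
Lemma dsum_finite L (u : coeffs) : vanishes_from L u ->
  dsum u = \sum_(l < L) \sum_(m < l.+1) u l m.
Proof.
move=> uL; rewrite /dsum /csum; apply: (@lim_near_cst R[i]^o).
  exact: norm_hausdorff.
exists L => // n /= Ln.
rewrite /series /= (big_cat_nat (n := L))//= big_mkord.
rewrite [X in _ + X]big_nat_cond [X in _ + X]big1 ?addr0//.
by move=> l /andP[/andP[Ll _] _]; apply: big1 => m _; exact: uL.
Qed.

Lemma abs_summable_finite L (u : coeffs) : vanishes_from L u -> abs_summable u.
Proof.
move=> uL; rewrite /abs_summable.
pose s l := \sum_(m < l.+1) modulus (u l m).
suff -> : (\sum_(0 <= l <oo) (s l)%:E = (\sum_(0 <= l < L) s l)%:E)%E.
  by rewrite ltry.
apply: lim_near_cst => //; exists L => // n /= Ln.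
rewrite -sumEFin (big_cat_nat (n := L))//=.
rewrite [X in (_ + X)%E]big_nat_cond [X in (_ + X)%E]big1 ?adde0//.
move=> l /andP[/andP[Ll _] _]; rewrite /s big1// => m _.
by rewrite uL// /modulus /= !expr0n /= addr0 sqrtr0.
Qed.

Variables (P : forall l : nat, 'I_l.+1 -> mpoly.mpoly 2 R[i]).
Variables (q : quadrature (R := R)).

Lemma synthesis_finite L (u : coeffs) (k : 'I_(qsize q)) : vanishes_from L u ->
  synthesis P u k = Complex (Num.sqrt (weight k)) 0 *
    \sum_(l < L) \sum_(m < l.+1) u l m * peval (P m) (node k).
Proof.
by move=> uL; rewrite /synthesis (@dsum_finite L)//
  => l m /(uL l m) ->; rewrite mul0r.
Qed.

Lemma synthesisD L (u v : coeffs) (k : 'I_(qsize q)) :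
    vanishes_from L u -> vanishes_from L v ->
  synthesis P (fun l m => u l m + v l m) k = synthesis P u k + synthesis P v k.
Proof.
move=> uL vL; rewrite !(synthesis_finite (L := L))// => [|l m Ll]; last first.
  by rewrite uL// vL// addr0.
rewrite -mulrDr -big_split/=; congr (_ * _); apply: eq_bigr => l _.
by rewrite -big_split/=; apply: eq_bigr => m _; rewrite mulrDl.
Qed.

Lemma synthesis_sum L (I : Type) (s : seq I) (u : I -> coeffs)
    (k : 'I_(qsize q)) : (forall i, vanishes_from L (u i)) ->
  synthesis P (fun l m => \sum_(i <- s) u i l m) k =
  \sum_(i <- s) synthesis P (u i) k.
Proof.
move=> uL; rewrite (synthesis_finite (L := L)) => [|l m Ll]; last first.
  by rewrite big1// => i _; exact: uL.
under [RHS]eq_bigr do rewrite (synthesis_finite (L := L))//.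
rewrite -mulr_sumr; congr (_ * _).
rewrite exchange_big/=; apply: eq_bigr => l _.
by rewrite exchange_big/=; apply: eq_bigr => m _; rewrite mulr_suml.
Qed.

(** The framelet is the combination of the P m, for degrees below L, with
    coefficients sqrt (weight k) * c l * conj (P m (node k)).  Since the inner
    product is conjugate-linear on the right, pairing f with it leaves
    P m (node k) unconjugated, as in a synthesis. *)
Lemma inner_framelet (f : plane -> R[i]) L (c : nat -> R[i])
    (k : 'I_(qsize q)) : L2 f -> (forall l, (L <= l)%N -> c l = 0) ->
  inner f (framelet P c k) =
  synthesis P (fun l m => fcoef P f m * conjc (c l)) k.
Proof.
move=> fL2 cL; rewrite (synthesis_finite (L := L)) => [|l m /cL ->]; last first.
  by rewrite rmorph0 mulr0.
pose w := Complex (Num.sqrt (weight k)) 0.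
(* The double sum is flattened into one sum over the pairs (l, m). *)
pose e (i : {l : 'I_L & 'I_l.+1}) :=
  w * (c (tag i) * conjc (peval (P (tagged i)) (node k))).
transitivity (inner f (fun x => \sum_i e i * peval (P (tagged i)) x)).
  congr inner; apply/funext => x.
  rewrite /framelet (@dsum_finite L); last first.
    by move=> l m /cL ->; rewrite !mul0r.
  rewrite sig_big_dep mulr_sumr; apply: eq_bigr => -[l m] _.
  by rewrite mulrA.
rewrite inner_sum// sig_big_dep mulr_sumr; apply: eq_bigr => -[l m] _.
rewrite -/w /e; have : conjc w = w by rewrite /w /= oppr0.
by clearbody w => wJ; rewrite !rmorphM/= conjcK wJ /fcoef; ring.
Qed.

End finite_support.

(** * From the support of the generators to a bound on the degree *)

Section spectral_cutoff.
Context {R : realType}.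

Lemma le_lambda l : l%:R <= lambda l :> R.
Proof.
rewrite -[leLHS]ger0_norm// -sqrtr_sqr /lambda ler_wsqrtr//.
by rewrite -natrX ler_nat expnS expn1 leq_mul2l leq_addr orbT.
Qed.

Lemma vanish_of_support (g : R -> R[i]) :
  closure [set xi | 0 <= xi /\ g xi != 0] `<=` `[0, 1/2] ->
  forall xi, 1/2 < xi -> g xi = 0.
Proof.
move=> supp xi xi2; apply/eqP/negPn/negP => gxi.
have /supp : closure [set xi | 0 <= xi /\ g xi != 0] xi.
  by apply: subset_closure; split=> //; lra.
by rewrite /= in_itv/= => /andP[_]; rewrite leNgt xi2.
Qed.

(** lambda l / 2 ^ j >= l / 2 ^ j >= 1 once l >= 2 ^ j, well outside of the
    support. *)
Lemma vanish_lambda (g : R -> R[i]) : (forall xi, 1/2 < xi -> g xi = 0) ->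
  forall j l, (2 ^ j <= l)%N -> g (lambda l / 2 ^+ j) = 0.
Proof.
move=> g0 j l jl; apply: g0; rewrite ltr_pdivlMr ?exprn_gt0//.
apply: lt_le_trans (le_lambda l); apply: lt_le_trans (_ : (2 ^ j)%:R <= _).
  have : 0 < (2 : R) ^+ j by rewrite exprn_gt0.
  by rewrite natrX; lra.
by rewrite ler_nat.
Qed.

End spectral_cutoff.

(** * The decomposition of the framelet coefficients *)

Theorem proposition3 (R : realType)
  (P : forall l : nat, 'I_l.+1 -> mpoly.mpoly 2 R[i])
  (r : nat)
  (alpha : R -> R[i]) (beta : 'I_r -> R -> R[i])
  (a : int -> R[i]) (b : 'I_r -> int -> R[i])
  (Q : nat -> quadrature (R := R))
  (f : measurableTypeR R * measurableTypeR R -> R[i])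
  (P_basis : forall l, orthonormal_basis (P l))
  (r_ge1 : (1 <= r)%N)
  (alpha_L1 : in_Lp 1 lebesgue_measure setT alpha)
  (beta_L1 : forall n, in_Lp 1 lebesgue_measure setT (beta n))
  (a_l1 : l1_mask a)
  (b_l1 : forall n, l1_mask (b n))
  (refine_alpha : forall xi : R,
     fourier alpha (2 * xi) = mask_fourier a xi * fourier alpha xi)
  (refine_beta : forall n (xi : R),
     fourier (beta n) (2 * xi) = mask_fourier (b n) xi * fourier alpha xi)
  (supp_alpha :
     closure [set xi : R | 0 <= xi /\ fourier alpha xi != 0] `<=` `[0, 1/2])
  (supp_beta : forall n,
     closure [set xi : R | 0 <= xi /\ fourier (beta n) xi != 0] `<=` `[0, 1/2])
  (a_lim : forall l : nat,
     (fun j : nat => mask_fourier a (lambda l / 2 ^+ j) : R[i]^o) @ \oo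
       --> (1 : R[i]^o))
  (partition_unity : forall j l : nat,
     modulus (mask_fourier a (lambda l / 2 ^+ j)) ^+ 2 +
     \sum_(n < r) modulus (mask_fourier (b n) (lambda l / 2 ^+ j)) ^+ 2 = 1)
  (f_L2 : L2 f) :
  let v := vseq P Q alpha f in
  let w := fun n : 'I_r => wseq P Q (beta n) f in
  (* the framelet coefficient sequences are elements of l(Q) *)
  (forall j, in_lQ P (v j)) /\
  (forall n j, in_lQ P (w n j)) /\
  (* v_j = (v_{j-1} up_j) *_j a + sum_n w^n_{j-1} *_j b_n for every j >= 1,
     both entrywise and for the carried Fourier coefficients *)
  (forall j : nat,
    (forall k : 'I_(qsize (Q j.+1)),
      v j.+1 k =
        convolve P Q j.+1 (upsample P Q j.+1 (v j)) a k +
        \sum_(n < r) convolve P Q j.+1 (w n j) (b n) k) /\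
    (forall (l : nat) (m : 'I_l.+1),
      coef (v j.+1) m =
        coef (convolve P Q j.+1 (upsample P Q j.+1 (v j)) a) m +
        \sum_(n < r) coef (convolve P Q j.+1 (w n j) (b n)) m)).
Proof.
have alpha0 := vanish_of_support supp_alpha.
have beta0 n := vanish_of_support (supp_beta n).
move=> v w.
have coef_v j l (m : 'I_l.+1) :
  coef (v j) m = fcoef P f m * conjc (fourier alpha (lambda l / 2 ^+ j)) by [].
have coef_w n j l (m : 'I_l.+1) : coef (w n j) m =
  fcoef P f m * conjc (fourier (beta n) (lambda l / 2 ^+ j)) by [].
have coef_conv j (u : qseq (Q j)) h l (m : 'I_l.+1) :
  coef (convolve P Q j u h) m =
  coef u m * mask_fourier h (lambda l / 2 ^+ j) by [].
have v_van j : vanishes_from (2 ^ j) (coef (v j)).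
  by move=> l m jl; rewrite coef_v (vanish_lambda alpha0)// rmorph0 mulr0.
have w_van n j : vanishes_from (2 ^ j) (coef (w n j)).
  by move=> l m jl; rewrite coef_w (vanish_lambda (beta0 n))// rmorph0 mulr0.
have v_lQ j : in_lQ P (v j).
  split; first exact: abs_summable_finite (v_van j).
  move=> k; apply: (@inner_framelet _ _ _ _ (2 ^ j)) => // l.
  exact: vanish_lambda.
have w_lQ n j : in_lQ P (w n j).
  split; first exact: abs_summable_finite (w_van n j).
  move=> k; apply: (@inner_framelet _ _ _ _ (2 ^ j)) => // l.
  exact: (vanish_lambda (beta0 n)).
(* The cut-off of the upsampling is where the support of alpha^ ends. *)
have up_coef j l (m : 'I_l.+1) :
    coef (upsample P Q j.+1 (v j)) m = coef (v j) m.
  transitivity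
    (if lambda l <= (2 : R) ^ (j.+1%:Z - 2) then coef (v j) m else 0).
    by [].
  case: ifPn => //; rewrite -ltNge => big.
  rewrite coef_v alpha0 ?rmorph0 ?mulr0// ltr_pdivlMr ?exprn_gt0//.
  suff -> : 1 / 2 * 2 ^+ j = 2 ^ (j.+1%:Z - 2) :> R by [].
  have -> : j.+1%:Z - 2 = j%:Z + (- 1) by rewrite intS; ring.
  by rewrite expfzDr// exprnP mulrC exprN1 mul1r.
have coefE j l (m : 'I_l.+1) : coef (v j.+1) m =
    coef (convolve P Q j.+1 (upsample P Q j.+1 (v j)) a) m +
    \sum_(n < r) coef (convolve P Q j.+1 (w n j) (b n)) m.
  have half : lambda l / 2 ^+ j = 2 * (lambda l / 2 ^+ j.+1) :> R.
    by rewrite exprS; field; rewrite expf_neq0.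
  set xi := lambda l / 2 ^+ j.+1 in half *.
  have unity : mask_fourier a xi * conjc (mask_fourier a xi) +
      \sum_(n < r) mask_fourier (b n) xi * conjc (mask_fourier (b n) xi) = 1.
    rewrite mul_conjc; under eq_bigr do rewrite mul_conjc.
    transitivity (real_complex R 1); last by [].
    by rewrite -[in RHS](partition_unity j.+1 l) rmorphD rmorph_sum.
  rewrite coef_conv up_coef !coef_v -/xi half refine_alpha rmorphM.
  rewrite -[LHS]mulr1 -unity mulrDr mulr_sumr; congr (_ + _); first by ring.
  by apply: eq_bigr => n _; rewrite coef_conv (coef_w n j) -/xi half
    refine_beta rmorphM; ring.
split=> //; split=> // j; split=> [k|l m]; last exact: coefE.
pose L := (2 ^ j)%N.
have a_van : vanishes_from L
    (coef (convolve P Q j.+1 (upsample P Q j.+1 (v j)) a)).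
  by move=> l m Ll; rewrite coef_conv up_coef v_van ?mul0r.
have b_van n : vanishes_from L (coef (convolve P Q j.+1 (w n j) (b n))).
  by move=> l m Ll; rewrite coef_conv w_van// mul0r.
have sum_van : vanishes_from L (fun l m =>
    \sum_(n < r) coef (convolve P Q j.+1 (w n j) (b n)) m).
  by move=> l m Ll; apply: big1 => n _; exact: b_van.
rewrite (v_lQ j.+1).2.
have -> : coef (v j.+1) = (fun l m =>
    coef (convolve P Q j.+1 (upsample P Q j.+1 (v j)) a) m +
    \sum_(n < r) coef (convolve P Q j.+1 (w n j) (b n)) m).
  by apply/functional_extensionality_dep => l; apply/funext => m; exact: coefE.
by rewrite (synthesisD _ _ a_van sum_van) (synthesis_sum _ _ _ b_van).
Qed.
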